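(* Let $n\ge 1$, let $\Lambda_n\subset\mathbb{Q}[x_1,\dots,x_n]$ be the algebra of symmetric polynomials in $n$ variables over $\mathbb{Q}$, and let $p_k=x_1^k+x_2^k+\cdots+x_n^k$. Consider the operators on $\Lambda_n$ $$D_+=\sum_{i=1}^n x_i^2\frac{\partial}{\partial x_i},\qquad D_-=-\sum_{i=1}^n\frac{\partial}{\partial x_i},$$ and for $i=2,3,\dots,n$ put $$z_i=\sum_{k=0}^{i-2}(-1)^k n^{i-k-1}\binom{i}{k}p_{i-k}\,p_1^k+(i-1)(-1)^{i+1}p_1^i .$$ Then: (i) $\ker D_-=\mathbb{Q}[z_2,z_3,\dots,z_n]$; (ii) $\ker D_+=\mathbb{Q}$; (iii) $\Lambda_n=\mathbb{Q}[p_1,z_2,z_3,\dots,z_n]$.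
   Context: Both operators map symmetric polynomials to symmetric polynomials, and they are considered as linear operators on $\Lambda_n$ only; thus $\ker D_\pm=\{f\in\Lambda_n : D_\pm(f)=0\}$. For elements $a_1,\dots,a_m\in\Lambda_n$, $\mathbb{Q}[a_1,\dots,a_m]$ denotes the $\mathbb{Q}$-subalgebra of $\Lambda_n$ they generate (equal to $\mathbb{Q}$ if the list is empty). *)

(* Defs.v *)
From mathcomp Require Import all_boot all_order all_algebra.
From mathcomp Require Import mpoly.

Set Implicit Arguments.
Unset Strict Implicit.
Unset Printing Implicit Defensive.

Import GRing.Theory.
Local Open Scope ring_scope.

(* The R-subalgebra of A generated by s, i.e. the scalars if s is empty.      *)
(* The constructors are the closure conditions of GRing.subalg_closed         *)
(* together with membership of the generators; the predicate is Prop-valued   *)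
(* because membership in a generated subalgebra is not decidable in general.  *)
Inductive gen_subalg (R : comPzRingType) (A : algType R) (s : seq A) :
    A -> Prop :=
| gen_subalg_mem a : a \in s -> gen_subalg s a
| gen_subalg1 : gen_subalg s 1
| gen_subalg_lin (c : R) u v :
    gen_subalg s u -> gen_subalg s v -> gen_subalg s (c *: u + v)
| gen_subalgM u v :
    gen_subalg s u -> gen_subalg s v -> gen_subalg s (u * v).

Section Operators.

Variable n : nat.

(* The algebra of symmetric polynomials is the subset "\is symmetric" of      *)
(* {mpoly rat[n]}. The two operators below are given by their formulas on all *)
(* of {mpoly rat[n]}; kerL restricts them to symmetric arguments.             *)
Definition Dplus (f : {mpoly rat[n]}) : {mpoly rat[n]} :=
  \sum_(i < n) 'X_i ^+ 2 * f^`M(i).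

Definition Dminus (f : {mpoly rat[n]}) : {mpoly rat[n]} :=
  - \sum_(i < n) f^`M(i).

Definition kerL (D : {mpoly rat[n]} -> {mpoly rat[n]}) (f : {mpoly rat[n]}) :
    Prop :=
  f \is symmetric /\ D f = 0.

Definition psum (k : nat) : {mpoly rat[n]} := \sum_(i < n) 'X_i ^+ k.

(* Meant for 2 <= i, where the truncated subtractions are exact.              *)
Definition zpoly (i : nat) : {mpoly rat[n]} :=
  \sum_(0 <= k < i.-1)
     ((-1) ^+ k * n%:R ^+ (i - k - 1) * 'C(i, k)%:R)
       *: (psum (i - k) * psum 1 ^+ k)
  + ((i - 1)%:R * (-1) ^+ (i + 1)) *: psum 1 ^+ i.

(* z_2, ..., z_n *)
Definition zseq : seq {mpoly rat[n]} := [seq zpoly i | i <- index_iota 2 n.+1].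

End Operators.

(* Main.v *)
(* Since sum_(k <= i) binom(i,k) n^(i-k) (-1)^k p_(i-k) p_1^k is the sum of
   the (n x_j - p_1)^i, one has n z_i = sum_j (n x_j - p_1)^i. The derivation
   D_- kills each n x_j - p_1, hence each z_i, while D_- p_1 = - n.
   As z_i = n^(i-1) p_i + (a polynomial in p_1, ..., p_(i-1)), Newton's
   identities give (iii). So f in ker D_- is a polynomial g in p_1 with
   coefficients in Q[z_2, ..., z_n], which D_- kills, and D_- f is then
   - n g'(p_1). Iterating D_- shows that p_1 is transcendental over ker D_-,
   so g' = 0 and f = g(0), which is (i).
   For (ii), let x^m be the leading monomial of f and i the least index with
   m_i > 0: nothing in f but x^m contributes to the coefficient of x_i x^m in
   D_+ f, which is therefore m_i times the leading coefficient. *)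
Require Import Defs.
From mathcomp Require Import all_boot all_order all_algebra perm.
From mathcomp Require Import mpoly.

Set Implicit Arguments.
Unset Strict Implicit.
Unset Printing Implicit Defensive.

Import Order.TTheory GRing.Theory Num.Theory.
Local Open Scope ring_scope.

(** * Generated subalgebras: closure properties and splitting off one generator *)

Section GeneratedSubalgebra.

Variables (R : comPzRingType) (A : algType R).
Implicit Types (s t : seq A) (u v : A).

Lemma gen_subalg0 s : gen_subalg s 0.
Proof.
have := gen_subalg_lin (-1) (gen_subalg1 s) (gen_subalg1 s).
by rewrite scaleN1r addNr.
Qed.

Lemma gen_subalgZ s c u : gen_subalg s u -> gen_subalg s (c *: u).
Proof.
by move=> su; rewrite -[c *: u]addr0; apply/gen_subalg_lin/gen_subalg0.
Qed.

Lemma gen_subalgD s u v :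
  gen_subalg s u -> gen_subalg s v -> gen_subalg s (u + v).
Proof. by move=> su sv; rewrite -[u]scale1r; apply: gen_subalg_lin. Qed.

Lemma gen_subalgN s u : gen_subalg s u -> gen_subalg s (- u).
Proof. by rewrite -scaleN1r; apply: gen_subalgZ. Qed.

Lemma gen_subalgX s u k : gen_subalg s u -> gen_subalg s (u ^+ k).
Proof.
move=> su; elim: k => [|k IHk]; first exact: gen_subalg1.
by rewrite exprS; apply: gen_subalgM.
Qed.

Lemma gen_subalg_sum s (I : eqType) (r : seq I) (F : I -> A) :
  (forall i, i \in r -> gen_subalg s (F i)) -> gen_subalg s (\sum_(i <- r) F i).
Proof.
move=> sF; rewrite big_seq_cond; elim/big_rec: _ => [|i x /andP[ri _] sx].
  exact: gen_subalg0.
exact/gen_subalgD/sx/sF.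
Qed.

Lemma gen_subalg_prod s (I : eqType) (r : seq I) (F : I -> A) :
  (forall i, i \in r -> gen_subalg s (F i)) ->
  gen_subalg s (\prod_(i <- r) F i).
Proof.
move=> sF; rewrite big_seq_cond; elim/big_rec: _ => [|i x /andP[ri _] sx].
  exact: gen_subalg1.
exact/gen_subalgM/sx/sF.
Qed.

End GeneratedSubalgebra.

(** Isolates [a] as the variable of a one-variable polynomial, so that a derivation killing [s] acts
    through [a] alone. Such values contain the generators and are closed under linear combinations
    and products. *)
Lemma gen_subalg_cons_poly (R : comPzRingType) (A : comAlgType R) (a : A) s u :
  gen_subalg (a :: s) u ->
  exists2 g : {poly A}, forall i, gen_subalg s g`_i & u = g.[a].
Proof.
elim=> [b|||].
- rewrite inE => /orP[/eqP->|sb].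
    exists 'X => [i|]; last by rewrite hornerX.
    rewrite coefX; case: (i == 1)%N; [exact: gen_subalg1 | exact: gen_subalg0].
  exists b%:P => [i|]; last by rewrite hornerC.
  rewrite coefC; case: (i == 0)%N; [exact: gen_subalg_mem | exact: gen_subalg0].
- exists 1 => [i|]; last by rewrite hornerC.
  rewrite coef1; case: (i == 0)%N; [exact: gen_subalg1 | exact: gen_subalg0].
- move=> c v w _ [g sg ->] _ [h sh ->].
  exists (c%:A *: g + h) => [i|]; last by rewrite hornerD hornerZ mulr_algl.
  by rewrite coefD coefZ mulr_algl; apply: gen_subalg_lin.
- move=> v w _ [g sg ->] _ [h sh ->].
  exists (g * h) => [i|]; last by rewrite hornerM.
  by rewrite coefM; apply: gen_subalg_sum => j _; apply: gen_subalgM.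
Qed.

(** * Newton's identities for the coefficients of a product of linear factors *)

Section Newton.

Variable R : idomainType.

Lemma deriv_prod_seq (I : eqType) (r : seq I) (F : I -> {poly R}) : uniq r ->
  (\prod_(i <- r) F i)^`()
  = \sum_(i <- r) (F i)^`() * \prod_(j <- r | j != i) F j.
Proof.
elim: r => [_|a r IHr /= /andP[ra ur]]; first by rewrite !big_nil derivC.
rewrite big_cons derivM IHr // big_cons big_cons eqxx /= mulr_sumr.
have <- : \prod_(j <- r) F j = \prod_(j <- r | j != a) F j.
  rewrite big_seq [RHS]big_seq_cond; apply: eq_bigl => j.
  by case rj: (j \in r); rewrite //= (memPn ra).
congr (_ + _); apply: eq_big_seq => i ri.
by rewrite big_cons eq_sym (memPn ra) // mulrCA.
Qed.

(** Synthetic division: the recurrence [p_(j+1) = q_j - x q_(j+1)] between coefficients is solved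
    downwards from [q_n = 0]. *)
Lemma coef_div_XsubC n (p q : {poly R}) x k :
  (size q <= n)%N -> p = ('X - x%:P) * q ->
  q`_k = \sum_(k <= j < n) x ^+ (j - k) * p`_j.+1.
Proof.
move=> sq pE; have [nk|kn] := leqP n k.
  by rewrite big_geq // nth_default ?(leq_trans sq).
have pS j : p`_j.+1 = q`_j - x * q`_j.+1.
  by rewrite pE mulrBl coefB coefXM coefCM.
elim/ltn_ind: {k}(n - k)%N {-2}k (erefl (n - k)%N) kn => d IHd k dE kn.
rewrite big_ltn // subnn mul1r pS -addrA -[LHS]addr0; congr (_ + _).
apply/esym/eqP; rewrite addrC subr_eq0; apply/eqP.
have [nk|kn'] := leqP n k.+1.
  by rewrite big_geq // nth_default ?(leq_trans sq) // mulr0.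
rewrite (IHd (n - k.+1)%N) // -?dE ?ltn_sub2l // mulr_sumr.
apply: eq_big_seq => j.
by rewrite mem_index_iota => /andP[kj _]; rewrite mulrA -exprS -subSn // subSS.
Qed.

Lemma size_prod_XsubC_ord n (x : 'I_n -> R) :
  size (\prod_i ('X - (x i)%:P)) = n.+1.
Proof. by rewrite size_prod_XsubC /index_enum -enumT size_enum_ord. Qed.

(** Up to sign the coefficient of index [k] is the elementary symmetric function of degree [n - k]
    in the [x i]; the power sums on the right have degrees [1] to [n - k]. *)
Lemma newton n (x : 'I_n -> R) (p := \prod_i ('X - (x i)%:P)) k : (k <= n)%N ->
  p`_k *+ (n - k) = - \sum_(k <= j < n) (\sum_i x i ^+ (j - k).+1) * p`_j.+1.
Proof.
move=> kn; pose q i := \prod_(j | j != i) ('X - (x j)%:P).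
have pE i : p = ('X - (x i)%:P) * q i by rewrite /p (bigD1 i).
have sq i : (size (q i) <= n)%N.
  have size_p : size p = n.+1 by exact: size_prod_XsubC_ord.
  have nz_q : q i != 0.
    by apply: contra_eq_neq size_p => q0; rewrite (pE i) q0 mulr0 size_poly0.
  move: size_p; rewrite (pE i) size_mul ?polyXsubC_eq0 // size_XsubC add2n.
  by case=> ->.
have dp : p^`() = \sum_i q i.
  rewrite /p deriv_prod_seq ?index_enum_uniq //.
  by apply: eq_bigr => i _; rewrite derivXsubC mul1r.
(* Compare coefficients of X p' = sum_i (p + x_i q_i), as p = (X - x_i) q_i. *)
have : ('X * p^`())`_k = p`_k *+ n + \sum_i x i * (q i)`_k.
  rewrite dp mulr_sumr coef_sum -[n in _ *+ n]card_ord -sumr_const -big_split.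
  by apply: eq_bigr => i _; rewrite /= {1}(pE i) mulrBl coefB coefCM subrK.
have -> : ('X * p^`())`_k = p`_k *+ k.
  by rewrite coefXM; case: (k) => //= m; rewrite coef_deriv.
rewrite mulrnBr // => ->; rewrite opprD addrA subrr add0r; congr (- _).
under eq_bigr => i _ do rewrite (coef_div_XsubC k (sq i) (pE i)) mulr_sumr.
rewrite exchange_big; apply: eq_bigr => j _ /=.
by rewrite mulr_suml; apply: eq_bigr => i _; rewrite mulrA exprS.
Qed.

End Newton.

(** * Leading monomials and the kernel of [Dplus] *)

Lemma mlead_eq0_const n (R : idomainType) (f : {mpoly R[n]}) :
  mlead f = 0%MM -> f = (f@_0%MM)%:MP.
Proof.
have [->|nz_f] := eqVneq f 0; first by rewrite mcoeff0 mpolyC0.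
by move=> f0; apply: msize1_polyC; rewrite -mlead_deg // f0 mdeg0.
Qed.

Lemma mcoeff_XM n (R : comNzRingType) (f : {mpoly R[n]}) i m :
  ('X_i * f)@_m = if m i == 0%N then 0 else f@_(m - U_(i)).
Proof.
case: ifPn => [/eqP mi0|mi]; last first.
  have Um : (U_(i) <= m)%MM by rewrite lep1mP.
  by rewrite -{1}(submK Um) mulrC addmC mcoeffMX.
apply/eqP; rewrite mcoeff_eq0; apply/negP.
move=> /msuppM_le /allpairsP[[m1 m2] /= []].
rewrite msuppX inE => /eqP-> _ /(congr1 (fun m' : 'X_{1..n} => m' i)).
by rewrite mi0 mnmDE mnm1E eqxx.
Qed.

Section DplusKernel.

Variable n : nat.
Implicit Types f : {mpoly rat[n]}.

(** [x_j^2 d/dx_j] multiplies a monomial by [x_j] and by its exponent at [j], so only [m - U_(j)]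
    contributes, with exponent [(m j).-1]. *)
Lemma mcoeff_Dplus f m :
  (Dplus f)@_m = \sum_(j < n | m j != 0%N) f@_(m - U_(j)) *+ (m j).-1.
Proof.
rewrite /Dplus raddf_sum [RHS]big_mkcond; apply: eq_bigr => j _ /=.
rewrite expr2 -mulrA !mcoeff_XM; case: eqP => //= /eqP mj.
rewrite mnmBE mnm1E eqxx mcoeff_mderiv subn1.
case: eqP => [->|/eqP mj1]; first by rewrite mulr0n.
rewrite submK; last by rewrite lep1mP mnmBE mnm1E eqxx subn1.
by rewrite !mnmBE mnm1E eqxx !subn1 prednK // lt0n.
Qed.

Lemma Dplus_eq0 f : Dplus f = 0 -> f = (f@_0%MM)%:MP.
Proof.
move=> Df0; apply: mlead_eq0_const; apply/eqP; apply/negPn/negP => nz_m.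
set m := mlead f in nz_m *.
have [i mi0 i_min] : exists2 i : 'I_n,
    m i != 0%N & forall j : 'I_n, (j < i)%N -> m j = 0%N.
  have [i0 mi0] : exists i, m i != 0%N.
    apply/existsP; rewrite -negb_forall; apply: contra nz_m => /forallP m0.
    by apply/eqP/mnmP => j; rewrite mnm0E; apply/eqP.
  case: (@arg_minnP _ i0 (fun i => m i != 0%N) val mi0) => i mi i_min.
  exists i => // j ji.
  by apply/eqP; apply: contraLR ji => /i_min; rewrite -leqNgt.
have fm0 : f@_m != 0.
  rewrite mleadc_eq0; apply: contraNneq nz_m.
  by rewrite /m => ->; rewrite mlead0.
have := mcoeff_Dplus f (m + U_(i))%MM; rewrite Df0 mcoeff0.
rewrite (bigD1 i) ?mnmDE ?mnm1E ?eqxx ?addn1 //= big1 => [|j /andP[]].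
  rewrite addr0 addmK => /esym/eqP.
  by rewrite mulrn_eq0 (negbTE mi0) (negbTE fm0).
rewrite mnmDE mnm1E [i == j]eq_sym => mj ji; rewrite (negbTE ji) addn0 in mj *.
(* By minimality of [i], any other contributing [j] exceeds [i]. Then [U_(j) < U_(i)], so
   [m + U_(i) - U_(j)] lies above the leading monomial and has coefficient zero in [f]. *)
have ij : (i < j)%N.
  by rewrite ltn_neqAle eq_sym ji leqNgt; apply: contraNN mj => /i_min ->.
rewrite mcoeff_gt_mlead ?mul0rn //.
have mE : (m + U_(i) - U_(j) + U_(j) = m + U_(i))%MM.
  by rewrite submK // lep1mP mnmDE -lt0n ltn_addr // lt0n.
rewrite -(ltmc_add2l _ _ U_(j)) mE -/m ltmc_add2r.
apply/ltmcP; first by rewrite !mdeg1.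
exists i => [k ki|]; rewrite !mnm1E -!val_eqE /=.
  by rewrite (gtn_eqF ki) (gtn_eqF (ltn_trans ki ij)).
by rewrite eqxx gtn_eqF.
Qed.

End DplusKernel.

(** * Generation of the symmetric polynomials by power sums, then by [p_1, z_2, ..., z_n] *)

Section PowerSums.

Variable n : nat.
Implicit Types f g : {mpoly rat[n]}.

Lemma psum_sym k : psum n k \is symmetric.
Proof.
apply/issymP => s; rewrite raddf_sum /=.
rewrite [RHS](reindex_inj (@perm_inj _ s)); apply: eq_bigr => i _.
by rewrite rmorphXn /= /msym mmapX mmap1U.
Qed.

Lemma zpoly_sym i : zpoly n i \is symmetric.
Proof.
rewrite rpredD ?rpredZ ?rpredX ?psum_sym // rpred_sum // => k _.
by rewrite rpredZ // rpredM ?rpredX ?psum_sym.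
Qed.

Lemma gen_subalg_sym (s : seq {mpoly rat[n]}) f :
  {subset s <= symmetric} -> gen_subalg s f -> f \is symmetric.
Proof.
move=> ss; elim=> [a /ss //||c u v _ su _ sv|u v _ su _ sv].
- exact: rpred1.
- by rewrite rpredD ?rpredZ.
- exact: rpredM.
Qed.

(** Vieta's formula with the variables as roots; it links the elementary symmetric polynomials to
    the coefficients in [newton]. *)
Lemma mesym_prod_XsubC k : (k <= n)%N ->
  mesym n rat k =
  (-1) ^+ k * (\prod_(i < n) ('X - ('X_i : {mpoly rat[n]})%:P))`_(n - k).
Proof.
rewrite -ltnS => kn.
have := @mroots_coeff {mpoly rat[n]} n [tuple 'X_i | i < n] (Ordinal kn).
rewrite /= big_map big_enum /=.
move=> ->; rewrite mulrA -expr2 sqrr_sign mul1r !mesymE raddf_sum /=.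
apply: eq_bigr => h _; rewrite mevalX [LHS]mpolyXE_id.
by apply: eq_bigr => i _; rewrite tnth_mktuple.
Qed.

(** Downward induction from the leading coefficient [1]: [newton] gives [n - k] times the
    coefficient in terms of higher ones and power sums, and [n - k] is invertible in [rat]. *)
Lemma coef_prod_XsubC_gen (s : seq {mpoly rat[n]}) k :
  (forall i, (0 < i <= n)%N -> gen_subalg s (psum n i)) -> (k <= n)%N ->
  gen_subalg s (\prod_(i < n) ('X - ('X_i : {mpoly rat[n]})%:P))`_k.
Proof.
move=> sp; set p := \prod_i _.
elim/ltn_ind: {k}(n - k)%N {-2}k (erefl (n - k)%N) => d IHd k dE.
rewrite leq_eqVlt => /predU1P[->|kn].
  have -> : p`_n = lead_coef p.
    by rewrite lead_coefE size_prod_XsubC_ord.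
  by rewrite (monicP (monic_prod_XsubC _ _ _)); apply: gen_subalg1.
have nk0 : (n - k)%:R != 0 :> rat by rewrite pnatr_eq0 subn_eq0 -ltnNge.
have -> : p`_k = (n - k)%:R^-1 *: (p`_k *+ (n - k)).
  by rewrite -scaler_nat scalerA mulVf ?scale1r.
rewrite (newton _ (ltnW kn)); apply/gen_subalgZ/gen_subalgN/gen_subalg_sum => j.
rewrite mem_index_iota => /andP[kj jn]; apply: gen_subalgM.
  apply: sp; rewrite /= (leq_ltn_trans _ jn) ?leq_subr //.
by apply: (IHd (n - j.+1)%N); rewrite -?dE ?ltn_sub2l.
Qed.

Lemma sym_gen_psum (s : seq {mpoly rat[n]}) f :
  (forall i, (0 < i <= n)%N -> gen_subalg s (psum n i)) ->
  f \is symmetric -> gen_subalg s f.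
Proof.
move=> sp /sym_fundamental[t [<- _]]; rewrite comp_mpolyE.
apply: gen_subalg_sum => m _; apply/gen_subalgZ/gen_subalg_prod => i _.
rewrite tnth_mktuple mesym_prod_XsubC //; apply/gen_subalgX/gen_subalgM.
  exact/gen_subalgX/gen_subalgN/gen_subalg1.
exact/coef_prod_XsubC_gen/leq_subr.
Qed.

Lemma psum_gen_zseq i : (0 < n)%N -> (0 < i <= n)%N ->
  gen_subalg (psum n 1 :: zseq n) (psum n i).
Proof.
move=> n0; elim/ltn_ind: i => i IHi /andP[i0 lt_in].
have gp1 : gen_subalg (psum n 1 :: zseq n) (psum n 1).
  by apply: gen_subalg_mem; rewrite mem_head.
case: (ltngtP i 1) i0 => // [i1 _|->//].
have gz : gen_subalg (psum n 1 :: zseq n) (zpoly n i).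
  by apply: gen_subalg_mem; rewrite inE map_f ?orbT // mem_index_iota i1.
have n0' : n%:R != 0 :> rat by rewrite pnatr_eq0 -lt0n.
(* [w] is [z_i] without its [k = 0] term: a multiple of [p_1^i], and terms whose power sums
   [p_(i-k)], [0 < k < i - 1], fall under the induction hypothesis. *)
pose w := zpoly n i - n%:R ^+ i.-1 *: psum n i.
have -> : psum n i = (n%:R ^+ i.-1)^-1 *: (zpoly n i - w).
  by rewrite /w opprB addrC subrK scalerA mulVf ?expf_neq0 // scale1r.
apply/gen_subalgZ/gen_subalgD/gen_subalgN => //.
rewrite /w /zpoly big_ltn; last by rewrite -ltnS prednK // ltnW.
rewrite expr0 subn0 bin0 mulr1 mul1r mulr1 subn1 addrC !addrA addNr add0r.
apply: gen_subalgD; last exact/gen_subalgZ/gen_subalgX.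
apply: gen_subalg_sum => k; rewrite mem_index_iota => /andP[k0 ki].
apply/gen_subalgZ/gen_subalgM; last exact: gen_subalgX.
have lt_ki : (k < i)%N by rewrite (leq_trans ki) ?leq_pred.
apply: IHi; first by rewrite ltn_subrL k0 ltnW.
by rewrite subn_gt0 lt_ki (leq_trans (leq_subr _ _)).
Qed.

End PowerSums.

(** * The derivation [Dminus] and polynomials in [p_1] over its kernel *)

Section DminusKernel.

Variable n : nat.
Implicit Types f g : {mpoly rat[n]}.
Local Notation D := (@Dminus n).

Lemma DminusD f g : D (f + g) = D f + D g.
Proof.
rewrite /Dminus -opprD -big_split; congr (- _).
by apply: eq_bigr => i _; rewrite mderivD.
Qed.

Lemma DminusZ c f : D (c *: f) = c *: D f.
Proof.
rewrite /Dminus scalerN scaler_sumr; congr (- _).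
by apply: eq_bigr => i _; rewrite mderivZ.
Qed.

Lemma DminusM f g : D (f * g) = D f * g + f * D g.
Proof.
rewrite /Dminus mulNr mulrN -opprD mulr_suml mulr_sumr -big_split.
by congr (- _); apply: eq_bigr => i _; rewrite mderivM.
Qed.

Lemma Dminus0 : D 0 = 0.
Proof. by have := DminusZ 0 0; rewrite !scale0r. Qed.

Lemma Dminus1 : D 1 = 0.
Proof. by rewrite /Dminus big1 ?oppr0 // => i _; rewrite -mpolyC1 mderivC. Qed.

Lemma Dminus_sum I (r : seq I) (P : pred I) (F : I -> {mpoly rat[n]}) :
  D (\sum_(i <- r | P i) F i) = \sum_(i <- r | P i) D (F i).
Proof. exact: (big_morph _ DminusD Dminus0). Qed.

Lemma DminusX_eq0 f k : D f = 0 -> D (f ^+ k) = 0.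
Proof.
move=> Df0; elim: k => [|k IHk]; first exact: Dminus1.
by rewrite exprS DminusM Df0 IHk mul0r mulr0 addr0.
Qed.

Lemma Dminus_gen_eq0 s f :
  (forall a, a \in s -> D a = 0) -> gen_subalg s f -> D f = 0.
Proof.
move=> Ds; elim=> [a /Ds //||c u v _ Du _ Dv|u v _ Du _ Dv].
- exact: Dminus1.
- by rewrite DminusD DminusZ Du Dv scaler0 addr0.
- by rewrite DminusM Du Dv mul0r mulr0 addr0.
Qed.

Lemma Dminus_var i : D 'X_i = -1.
Proof.
rewrite /Dminus (bigD1 i) //= big1 ?addr0 => [|j ji].
  by rewrite mderivX mnm1E eqxx -{1}[U_(i)%MM]add0m addmK mpolyX0 scale1r.
by rewrite mderivX mnm1E eq_sym (negbTE ji) scale0r.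
Qed.

Lemma Dminus_psum1 : D (psum n 1) = - n%:R.
Proof.
rewrite Dminus_sum (eq_bigr (fun=> -1)) => [|i _]; last first.
  by rewrite expr1 Dminus_var.
by rewrite sumr_const card_ord mulNrn.
Qed.

Lemma zpolyE i : (0 < i)%N ->
  n%:R *: zpoly n i = \sum_(j < n) (n%:R *: 'X_j - psum n 1) ^+ i.
Proof.
case: i => // i _; set p1 := psum n 1.
pose T k : {mpoly rat[n]} :=
  ((-1) ^+ k * n%:R ^+ (i.+1 - k) * 'C(i.+1, k)%:R)
    *: (psum n (i.+1 - k) * p1 ^+ k).
have -> : \sum_(j < n) (n%:R *: 'X_j - p1) ^+ i.+1 = \sum_(0 <= k < i.+2) T k.
  under eq_bigr => j _ do rewrite exprDn.
  rewrite exchange_big big_mkord; apply: eq_bigr => k _ /=.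
  rewrite /T mulr_suml scaler_sumr; apply: eq_bigr => j _.
  rewrite exprZn -scaleN1r exprZn -scalerAl -scalerAr scalerA.
  rewrite -scaler_nat scalerA.
  by congr (_ *: _); rewrite mulrC [_ * (-1) ^+ _]mulrC.
(* As [p_0 = n], the last two binomial terms are both multiples of [p_1^(i+1)]. Their binomials
   [i + 1] and [1] carry opposite signs and leave the factor [i]: this is [n] times the separate
   last term of [zpoly]. *)
have Tlast : T i + T i.+1 = (n%:R * (i%:R * (-1) ^+ i)) *: p1 ^+ i.+1.
  rewrite /T subSnn subnn binSn binn !expr0 !mulr1 expr1 -/p1 -exprS.
  have -> : psum n 0 = n%:R%:A.
    rewrite /psum (eq_bigr (fun=> 1)) => [|j _]; last exact: expr0.
    by rewrite sumr_const card_ord scaler_nat.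
  rewrite -scalerAl mul1r scalerA -scalerDl; congr (_ *: _).
  by rewrite exprS mulN1r mulNr -natr1 mulrDr mulr1 addrK -mulrA mulrC -mulrA.
rewrite big_nat_recr //= big_nat_recr //= -addrA Tlast.
rewrite /zpoly -/p1 scalerDr scaler_sumr.
congr (_ + _).
  apply: eq_big_nat => k /andP[_ ki]; rewrite scalerA /T; congr (_ *: _).
  by rewrite mulrA mulrCA subnAC subn1 subSn ?(ltnW ki) //= [in RHS]exprS mulrA.
by rewrite scalerA subn1 addn1 !exprS !mulN1r opprK.
Qed.

Lemma Dminus_zpoly i : (0 < n)%N -> (0 < i)%N -> D (zpoly n i) = 0.
Proof.
move=> n0 i0; have n0' : n%:R != 0 :> rat by rewrite pnatr_eq0 -lt0n.
apply: (scalerI n0'); rewrite scaler0 -DminusZ zpolyE // Dminus_sum.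
rewrite big1 // => j _.
apply: DminusX_eq0; rewrite DminusD DminusZ Dminus_var -[- psum n 1]scaleN1r.
by rewrite DminusZ Dminus_psum1 scaler_nat scaleN1r opprK mulNrn addNr.
Qed.

(** Chain rule: the coefficients of [g] are constants for the derivation [D]. *)
Lemma Dminus_horner (g : {poly {mpoly rat[n]}}) f :
  (forall i, D g`_i = 0) -> D g.[f] = g^`().[f] * D f.
Proof.
elim/poly_ind: g => [_|g c IHg Dg].
  by rewrite deriv0 horner0 Dminus0 mul0r.
have Dc : D c = 0 by have := Dg 0%N; rewrite coefD coefMX coefC eqxx add0r.
have Dg' i : D g`_i = 0 by have := Dg i.+1; rewrite coefD coefMX coefC /= addr0.
rewrite derivMXaddC hornerMXaddC hornerD hornerMX DminusD DminusM Dc addr0.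
by rewrite IHg // mulrDl addrC mulrAC.
Qed.

(** In the chain rule the factor [D p_1 = - n] is a nonzero constant and cancels. *)
Lemma Dminus_horner_psum1 (g : {poly {mpoly rat[n]}}) : (0 < n)%N ->
  (forall i, D g`_i = 0) -> D g.[psum n 1] = 0 -> g^`().[psum n 1] = 0.
Proof.
move=> n0 Dg; rewrite Dminus_horner // Dminus_psum1 => /eqP.
rewrite mulf_eq0 oppr_eq0 -mpolyC_nat mpolyC_eq0 pnatr_eq0 eqn0Ngt n0 orbF.
by move/eqP.
Qed.

Lemma deriv_eq0 (g : {poly {mpoly rat[n]}}) : g^`() = 0 -> g = (g`_0)%:P.
Proof.
move=> dg0; apply/polyP => -[|i]; rewrite coefC //=.
have /eqP := coef_deriv g i; rewrite dg0 coef0 eq_sym -scaler_nat.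
by rewrite scaler_eq0 pnatr_eq0 => /eqP.
Qed.

(** Induction on the size: the derivative of [g] also vanishes at [p_1], so it is zero; then [g] is
    constant and equals its value at [p_1]. *)
Lemma psum1_transcendental (g : {poly {mpoly rat[n]}}) : (0 < n)%N ->
  (forall i, D g`_i = 0) -> g.[psum n 1] = 0 -> g = 0.
Proof.
move=> n0; have [m] := ubnP (size g); elim: m g => // m IHm g /ltnSE sg Dg g0.
have [->//|nz_g] := eqVneq g 0.
have dg0 : g^`() = 0.
  apply: IHm => [|i|]; first exact: leq_trans (lt_size_deriv nz_g) sg.
    by rewrite coef_deriv -scaler_nat DminusZ Dg scaler0.
  by apply: Dminus_horner_psum1; rewrite ?g0 ?Dminus0.
by move: g0; rewrite (deriv_eq0 dg0) hornerC => ->.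
Qed.

End DminusKernel.

Theorem theorem1 (n : nat) (hn : (1 <= n)%N) :
  [/\ forall f : {mpoly rat[n]},
        kerL (@Dminus n) f <-> gen_subalg (zseq n) f,
      forall f : {mpoly rat[n]},
        kerL (@Dplus n) f <-> exists c : rat, f = c%:MP
    & forall f : {mpoly rat[n]},
        f \is symmetric <-> gen_subalg (psum n 1 :: zseq n) f].
Proof.
have zP a : a \in zseq n -> exists2 i, (0 < i)%N & a = zpoly n i.
  case/mapP => i; rewrite mem_index_iota => /andP[i1 _] ->.
  by exists i; rewrite // ltnW.
have Dz a : a \in zseq n -> Dminus a = 0.
  by case/zP => i i0 ->; apply: Dminus_zpoly.
have sz : {subset zseq n <= symmetric}.
  by move=> a /zP[i _ ->]; apply: zpoly_sym.
have iii f : f \is symmetric <-> gen_subalg (psum n 1 :: zseq n) f.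
  split; first by apply: sym_gen_psum => i; apply: psum_gen_zseq.
  apply: gen_subalg_sym => a; rewrite inE => /predU1P[->|/sz//].
  exact: psum_sym.
split=> // f; split.
- case=> /iii/gen_subalg_cons_poly[g zg ->] Dg0.
  have Dg i : Dminus g`_i = 0 by apply: Dminus_gen_eq0 (zg i).
  (* A constant [g] takes as value its constant coefficient, which [zg] puts in the subalgebra.
     Constancy holds because the derivative of [g] vanishes at [p_1] and has coefficients killed by
     [Dminus]. *)
  suff -> : g = (g`_0)%:P by rewrite hornerC.
  apply/deriv_eq0/psum1_transcendental => // [i|]; last first.
    exact: Dminus_horner_psum1.
  by rewrite coef_deriv -scaler_nat DminusZ Dg scaler0.
- move=> zf; split; last exact: Dminus_gen_eq0 zf.
  exact: gen_subalg_sym zf.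
- by case=> _ /Dplus_eq0 ->; eexists.
- case=> c ->; split; first by rewrite -alg_mpolyC rpredZ ?rpred1.
  by rewrite /Dplus big1 // => i _; rewrite mderivC mulr0.
Qed.
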